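(* Let $A\in\mathbb{R}_{\max}^{d\times d}$ be irreducible, let $\gamma$ be the cyclicity of $\mathcal{G}(A)$, and let $Z$ be a cycle of $\mathcal{G}(A)$ of length $l(Z)$. Then $$T_{cr}^{l(Z)}(A,Z)\le l(Z)\left\lfloor\frac{d}{\gamma}\right\rfloor+d-l(Z)-1.$$
   Context: $\mathbb{R}_{\max}=\mathbb{R}\cup\{-\infty\}$. For $A\in\mathbb{R}_{\max}^{d\times d}$, $\mathcal{G}(A)$ is the digraph with nodes $1,\dots,d$ and an arc $(i,j)$ whenever $a_{ij}\neq-\infty$. The length $l(W)$ of a walk $W$ is its number of arcs. A cycle is a closed walk with at least one arc and no repeated node other than its coinciding ends; it is also regarded as a subgraph. $A$ is irreducible if $\mathcal{G}(A)$ is strongly connected. The cyclicity of a strongly connected digraph is the gcd of the lengths of its cycles. Cycle removal threshold: for a subgraph $\mathcal{G}$ of $\mathcal{G}(A)$ and a positive integer $\sigma$, $T_{cr}^{\sigma}(A,\mathcal{G})$ is the smallest nonnegative integer $T$ such that: for all nodes $i,j$ and each walk $W$ on $\mathcal{G}(A)$ from $i$ to $j$ that goes through a node of $\mathcal{G}$ and has length $\ge T$, there is a walk $V$ from $i$ to $j$ going through a node of $\mathcal{G}$, obtained from $W$ by removing cycles and possibly inserting cycles of $\mathcal{G}$, such that $l(V)\equiv l(W)\pmod\sigma$ and $l(V)\le T$. *)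

(* Defs.v *)
From mathcomp Require Import all_boot all_order all_algebra.
From mathcomp Require Import constructive_ereal reals.

Set Implicit Arguments.
Unset Strict Implicit.
Unset Printing Implicit Defensive.

Definition Rmax (R : realType) : Type := {x : \bar R | x != +oo%E}.

Record digraph (T : finType) := Digraph {
  nodes : {set T};
  arcs : rel T;
  arcs_nodes : forall x y, arcs x y -> (x \in nodes) && (y \in nodes)
}.

Definition subgraph (T : finType) (G H : digraph T) : Prop :=
  nodes G \subset nodes H /\ subrel (arcs G) (arcs H).

Definition strongly_connected (T : finType) (G : digraph T) : Prop :=
  {in nodes G &, forall x y, connect (arcs G) x y}.

(* A walk x_0, x_1, ..., x_n is given by its start x_0 and the sequence
   p = [:: x_1; ...; x_n], so that its length is size p. *)
Definition walk (T : finType) (G : digraph T) (x y : T) (p : seq T) : bool :=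
  [&& x \in nodes G, path (arcs G) x p & last x p == y].

Definition goes_through (T : finType) (G : digraph T) (x : T) (p : seq T) :
  bool := has (mem (nodes G)) (x :: p).

(* c lists the nodes of the cycle once each, in cyclic order: the last node
   has an arc to the first one, and the length is size c. *)
Definition is_cycle (T : finType) (G : digraph T) (c : seq T) : bool :=
  [&& c != [::], cycle (arcs G) c & uniq c].

Section CycleGraph.
Variables (T : finType) (c : seq T).

Let cycle_arc : rel T := fun x y => (x \in c) && (y == next c x).

Fact cycle_arc_nodes x y :
  cycle_arc x y -> (x \in [set z in c]) && (y \in [set z in c]).
Proof. by case/andP=> cx /eqP->; rewrite !inE mem_next cx. Qed.

Definition cycle_graph : digraph T := Digraph cycle_arc_nodes.

End CycleGraph.

Lemma cycle_graph_sub (T : finType) (G : digraph T) (c : seq T) :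
  is_cycle G c -> subgraph (cycle_graph c) G.
Proof.
case/and3P=> _ cyc _; have arc x : x \in c -> arcs G x (next c x).
  by move=> cx; apply: next_cycle.
split; last by move=> x y /andP[cx /eqP->]; apply: arc.
apply/subsetP=> x; rewrite inE => /arc /arcs_nodes.
by case/andP.
Qed.

(* The nodes of a cycle are distinct, so its length is at most #|T|. *)
Definition cyclicity (T : finType) (G : digraph T) : nat :=
  \big[gcdn/0%N]_(n < #|T|.+1 | [exists c : n.-tuple T, is_cycle G c]) n.

Lemma dvdn_cyclicity (T : finType) (G : digraph T) (m : nat) :
  (m %| cyclicity G)%N <-> (forall c, is_cycle G c -> (m %| size c)%N).
Proof.
split=> [/dvdn_biggcdP dvd_m c Gc | dvd_m].
  have lt_c : (size c < #|T|.+1)%N.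
    by case/and3P: Gc => _ _ Uc; rewrite ltnS -(card_uniqP Uc) max_card.
  by apply: (dvd_m (Ordinal lt_c)); apply/existsP; exists (in_tuple c).
apply/dvdn_biggcdP => n /existsP[c Gc].
by rewrite -(size_tuple c); apply: dvd_m.
Qed.

(* remove_cycles G x p q: the walk (x, q) results from the walk (x, p) by
   removing, one after the other, subwalks that are cycles of G. In the second
   constructor c lists the nodes following last x p1 in a closed walk from and
   to last x p1, and is thus a cycle listed so that last x p1 comes last. *)
Inductive remove_cycles (T : finType) (G : digraph T) (x : T) :
    seq T -> seq T -> Prop :=
| remove_none p : remove_cycles G x p p
| remove_cons p1 c p2 q :
    is_cycle G c -> last (last x p1) c = last x p1 ->
    remove_cycles G x (p1 ++ p2) q ->
    remove_cycles G x (p1 ++ c ++ p2) q.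

(* Inserting cycles is the converse of removing them: u is w with cycles of H
   removed, and v is u with cycles of G inserted. *)
Definition remove_insert (T : finType) (H G : digraph T) (x : T)
    (w v : seq T) : Prop :=
  exists2 u, remove_cycles H x w u & remove_cycles G x v u.

Section MaxPlus.
Variables (R : realType) (d : nat).
Implicit Types (A : 'M[Rmax R]_d) (G : digraph 'I_d).

Let mx_arc A : rel 'I_d := fun i j => val (A i j) != -oo%E.

Fact mx_arc_nodes A i j :
  mx_arc A i j -> (i \in [set: 'I_d]) && (j \in [set: 'I_d]).
Proof. by rewrite !inE. Qed.

Definition digraph_of A : digraph 'I_d := Digraph (@mx_arc_nodes A).

Definition irreducible A : Prop := strongly_connected (digraph_of A).

Definition cycle_removal A G (sigma T : nat) : Prop :=
  forall (i j : 'I_d) (w : seq 'I_d),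
    walk (digraph_of A) i j w -> goes_through G i w -> (T <= size w)%N ->
  exists v : seq 'I_d,
    [/\ walk (digraph_of A) i j v,
        goes_through G i v,
        remove_insert (digraph_of A) G i w v,
        size v = size w %[mod sigma]
      & (size v <= T)%N].

Definition is_Tcr A G (sigma T : nat) : Prop :=
  cycle_removal A G sigma T /\
  forall T' : nat, cycle_removal A G sigma T' -> (T <= T')%N.

End MaxPlus.

(* Main.v *)
Require Import Defs.
From mathcomp Require Import all_boot all_order all_algebra.
From mathcomp Require Import constructive_ereal reals boolp.
From mathcomp Require Import zify.

Set Implicit Arguments.
Unset Strict Implicit.
Unset Printing Implicit Defensive.

(* Let [g] be the cyclicity, [Z] the given cycle, [s := size Z / g],
   [q := d / g] and [r := d mod g]. The positions at which a walk visits a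
   fixed node are congruent modulo [g], so among [s + 1] of them two are
   congruent modulo [s * g = size Z], and the closed walk between them can be
   removed. Hence, in a walk that cannot be shortened while keeping its length
   modulo [size Z] and a node of [Z], a node of [Z] occurs at most [s] times and
   any other node at most [s + 1] times. Each of the [g] cyclic classes contains
   [s] nodes of [Z], so a class [C] is visited at most [#|C| (s + 1) - s] times.
   A walk runs through the classes periodically: if its length exceeded the
   bound, every class would be visited [q (s + 1) - s] times and [r + 1] of them
   once more. Then [#|C| >= q] for every class, and [#|C| >= q + 1] for [r + 1]
   of them, so that there would be at least [q g + r + 1 = d + 1] nodes. *)

(** * Congruences: pigeonhole and counting in a residue class *)

Section Arithmetic.

Lemma eqn_modM (g n x y : nat) :
  x = y %[mod g] -> x %/ g = y %/ g %[mod n] -> x = y %[mod n * g].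
Proof.
have modM z : z %% (n * g) = ((z %/ g) %% n * g + z %% g) %[mod n * g].
  rewrite modn_mod [in LHS](divn_eq z g) [in LHS](divn_eq (z %/ g) n).
  by rewrite mulnDl -mulnA -addnA modnMDl.
by move=> xy qxy; rewrite -[LHS]modn_mod -[RHS]modn_mod !modM xy qxy.
Qed.

(** Once the residue modulo [g] is fixed, the residue modulo [n * g] depends only on the quotient by
    [g] taken modulo [n], which leaves [n] values. The map [f] allows positions to be shifted before
    they are compared. *)
Lemma pigeonhole_modn (f : nat -> nat) (g n a : nat) (s : seq nat) :
  0 < n -> uniq s -> {in s, forall p, f p = a %[mod g]} -> n < size s ->
  exists p1 p2,
    [/\ p1 \in s, p2 \in s, p1 < p2 & f p1 = f p2 %[mod n * g]].
Proof.
move=> n_gt0 Us fs lt_n_s.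
pose h p := (f p %/ g) %% n.
have : ~~ uniq [seq h p | p <- s].
  apply: contraL lt_n_s => /uniq_leq_size le_size.
  rewrite -leqNgt -(size_map h) -(size_iota 0 n) le_size // => _ /mapP[p _ ->].
  by rewrite mem_iota ltn_mod.
case/(uniqPn 0)=> a1 [a2]; rewrite size_map => -[lt12 lt2].
have lt1 := ltn_trans lt12 lt2.
rewrite !(nth_map 0) // => eq_h.
set p1 := nth 0 s a1 in eq_h; set p2 := nth 0 s a2 in eq_h.
have sp1 : p1 \in s by apply: mem_nth.
have sp2 : p2 \in s by apply: mem_nth.
have eq_f : f p1 = f p2 %[mod n * g].
  by apply: eqn_modM; rewrite ?(fs p1) ?(fs p2).
have : p1 != p2 by rewrite nth_uniq // neq_ltn lt12.
by rewrite neq_ltn => /orP[lt_p|lt_p]; [exists p1, p2 | exists p2, p1].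
Qed.

Lemma leq_count_modn (g N r b n : nat) :
  b < g -> N * g + r <= n ->
  N + (b < r) <= count (fun t => t %% g == b) (iota 0 n).
Proof.
move=> lt_b_g le_n; rewrite -size_filter.
have <- : size [seq t * g + b | t <- iota 0 (N + (b < r))] = N + (b < r).
  by rewrite size_map size_iota.
apply: uniq_leq_size => [|_ /mapP[t + ->]].
  rewrite map_inj_uniq ?iota_uniq // => x y /addIn/eqP.
  by rewrite eqn_pmul2r ?(leq_ltn_trans _ lt_b_g) // => /eqP.
rewrite mem_iota mem_filter mem_iota modnMDl modn_small // eqxx /= !add0n.
case: (ltnP b r) => [lt_b_r | _]; rewrite ?addn0 ?addn1 => lt_t.
  rewrite (leq_trans _ le_n) // -addnS leq_add // leq_mul2r.
  by rewrite -ltnS lt_t orbT.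
apply: leq_trans (leq_trans (leq_addr _ _) le_n).
by apply: (@leq_trans (t.+1 * g)); rewrite ?leq_mul2r ?lt_t ?orbT // mulSn; lia.
Qed.

End Arithmetic.

(** * Removing closed walks and shortening walks *)

Section Removal.
Variables (T : finType) (G : digraph T).
Implicit Types (x y : T) (c p w : seq T).

Lemma remove_cycles_trans x p q w :
  remove_cycles G x p q -> remove_cycles G x q w -> remove_cycles G x p w.
Proof.
by elim=> // p1 c p2 q' Gc last_c _ IH /IH; apply: remove_cons.
Qed.

Lemma remove_cycles_size x p q :
  remove_cycles G x p q -> size p = size q %[mod cyclicity G].
Proof.
elim=> // p1 c p2 q' Gc _ _ <-; rewrite !size_cat addnCA.
have /dvdnP[k ->] : cyclicity G %| size c by apply: (dvdn_cyclicity G _).1.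
by rewrite modnMDl.
Qed.

(** Induction on the length: if [c] is not a cycle, a node repeated at positions [a < b] splits it
    as [c1 ++ c2 ++ c3] with [c2] closed. First [c2] is removed, then the closed walk [c1 ++ c3];
    both are shorter than [c], since [c1] and [c2] are nonempty. *)
Lemma remove_closed_walk x p1 c p2 :
  path (arcs G) (last x p1) c -> last (last x p1) c = last x p1 ->
  remove_cycles G x (p1 ++ c ++ p2) (p1 ++ p2).
Proof.
have [n] := ubnP (size c); elim: n => // n IH in p1 c p2 * => lt_c Gc last_c.
have [->|c_nil] := eqVneq c [::]; first exact: remove_none.
have [Uc|] := boolP (uniq c).
  apply: (remove_cons _ last_c (remove_none _ _ _)).
  by rewrite /is_cycle c_nil Uc (cycle_path (last x p1)) last_c Gc.
case/(uniqPn x)=> a [b [lt_ab]].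
rewrite -[size c]/(@size T c) => lt_b eq_ab.
have lt_a := ltn_trans lt_ab lt_b.
set c1 := take a.+1 c; set c2 := take (b - a) (drop a.+1 c).
set c3 := drop b.+1 c.
have def_c : c = c1 ++ c2 ++ c3.
  have -> : c3 = drop (b - a) (drop a.+1 c).
    by rewrite drop_drop addnS subnK // ltnW.
  by rewrite !cat_take_drop.
have last1 y : last y c1 = nth x c a.
  by rewrite (last_nth x) size_takel //= nth_take.
have last2 y : last y (c1 ++ c2) = nth x c b.
  rewrite (_ : c1 ++ c2 = take b.+1 c); last first.
    by rewrite -takeD addSn subnKC // ltnW.
  by rewrite (last_nth x) size_takel //= nth_take.
move: Gc last_c; rewrite def_c !cat_path => /and3P[Gc1 Gc2 Gc3] last_c.
have last21 : last (last (last x p1) c1) c2 = last (last x p1) c1.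
  by rewrite -last_cat last2 last1 eq_ab.
have sz1 : size c1 = a.+1 by rewrite size_takel.
have sz2 : size c2 = b - a by rewrite size_takel // size_drop; lia.
have szc : size c = a.+1 + (b - a + size c3).
  by rewrite {1}def_c !size_cat sz1 sz2.
rewrite -!catA catA.
apply: (@remove_cycles_trans _ _ ((p1 ++ c1) ++ (c3 ++ p2))).
  by apply: IH; rewrite ?last_cat //; lia.
rewrite -catA [c1 ++ _]catA; apply: IH.
- by rewrite size_cat; lia.
- by rewrite cat_path Gc1 -last21.
- by move: last_c; rewrite !last_cat last21.
Qed.

(** Removing the whole closed walk leaves the empty walk, and removals preserve the length modulo
    the cyclicity. *)
Lemma closed_walk_dvd x c :
  path (arcs G) x c -> last x c = x -> cyclicity G %| size c.
Proof.
move=> Gc last_c; rewrite /dvdn -[X in _ == X](mod0n (cyclicity G)).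
have := @remove_closed_walk x [::] c [::] Gc last_c.
by rewrite cats0 => /remove_cycles_size ->.
Qed.

Lemma last_take x w t : t <= size w -> last x (take t w) = nth x (x :: w) t.
Proof.
by move=> le_t; rewrite (last_nth x) size_takel //; case: t le_t => //= t ?;
   rewrite nth_take.
Qed.

(** Positions refer to [x :: w], with the start at position 0, so dropping the entries
    [t1, ..., t2 - 1] of [w] deletes the part of the walk between positions [t1] and [t2]. *)
Definition cut (t1 t2 : nat) w := take t1 w ++ drop t2 w.

Lemma size_cut t1 t2 w :
  t1 <= t2 <= size w -> size (cut t1 t2 w) + (t2 - t1) = size w.
Proof.
case/andP=> le12 le2; rewrite size_cat size_drop size_takel; last lia.
by lia.
Qed.

Lemma nth_cut_before x t1 t2 w t :
  t <= t1 -> t1 <= t2 <= size w -> nth x (x :: cut t1 t2 w) t = nth x (x :: w) t.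
Proof.
move=> le_t /andP[le12 le2]; case: t le_t => //= t lt_t.
by rewrite nth_cat size_takel ?(leq_trans le12) // lt_t nth_take.
Qed.

Lemma cut_walk x y t1 t2 w :
  walk G x y w -> t1 <= t2 <= size w ->
  nth x (x :: w) t1 = nth x (x :: w) t2 ->
  walk G x y (cut t1 t2 w) /\ remove_cycles G x w (cut t1 t2 w).
Proof.
move=> /and3P[Gx Gw /eqP last_w] /andP[le12 le2].
have le1 := leq_trans le12 le2.
rewrite -!last_take // => eq12.
have def_t2 : take t2 w = take t1 w ++ take (t2 - t1) (drop t1 w).
  by rewrite -takeD subnKC.
have def_w : w = take t1 w ++ take (t2 - t1) (drop t1 w) ++ drop t2 w.
  by rewrite catA -def_t2 cat_take_drop.
move: eq12 (Gw) last_w; rewrite def_t2 last_cat => eq12.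
rewrite {1 2}def_w !cat_path !last_cat -eq12 => /and3P[G1 G2 G3] last_w.
split; first by rewrite /walk Gx cat_path last_cat G1 G3 last_w eqxx.
by rewrite {1}def_w; apply: remove_closed_walk.
Qed.

Lemma mem_cut x t1 t2 w t :
  t1 <= t2 <= size w -> t <= size w -> (t <= t1) || (t2 <= t) ->
  nth x (x :: w) t1 = nth x (x :: w) t2 ->
  nth x (x :: w) t \in x :: cut t1 t2 w.
Proof.
move=> le12 le_t le_tt eq12; have sz := size_cut le12.
have before u : u <= t1 -> nth x (x :: w) u \in x :: cut t1 t2 w.
  move=> le_u; rewrite -(nth_cut_before x le_u le12) mem_nth //=; lia.
case/orP: le_tt => [/before //|].
(* The visit at [t2] itself is deleted, but the same node survives at [t1]. *)
rewrite leq_eqVlt => /orP[/eqP <-|lt_t]; first by rewrite -eq12 before.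
case: t lt_t le_t => // t; rewrite ltnS /= => le_t lt_t.
rewrite inE mem_cat -[in nth _ w t](subnKC le_t) -nth_drop mem_nth ?orbT //.
by rewrite size_drop ltn_sub2r // (leq_ltn_trans le_t).
Qed.

Lemma visits_modn x y w t1 t2 :
  walk G x y w -> t1 <= size w -> t2 <= size w ->
  nth x (x :: w) t1 = nth x (x :: w) t2 -> t1 = t2 %[mod cyclicity G].
Proof.
move=> Gw; wlog le12 : t1 t2 / t1 <= t2 => [IH le1 le2 eq12 | _ le2 eq12].
  by case/orP: (leq_total t1 t2) => /IH -> //.
have le := introT andP (conj le12 le2).
have [_ /remove_cycles_size/eqP] := cut_walk Gw le eq12.
rewrite eqn_mod_dvd; last by have := size_cut le; lia.
rewrite -(size_cut le) addKn => dvd12.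
by apply/esym/eqP; rewrite eqn_mod_dvd.
Qed.

(** The position [k] is a visit of [A] outside the open interval being cut, so it witnesses that the
    shorter walk still meets [A]. *)
Lemma cut_shorten (A : {pred T}) m x y w t1 t2 k :
  walk G x y w -> t1 < t2 <= size w ->
  nth x (x :: w) t1 = nth x (x :: w) t2 -> t1 = t2 %[mod m] ->
  k <= size w -> (k <= t1) || (t2 <= k) -> nth x (x :: w) k \in A ->
  exists w', [/\ walk G x y w', has (mem A) (x :: w'), remove_cycles G x w w',
    size w' = size w %[mod m] & size w' < size w].
Proof.
move=> Gw /andP[lt12 le2] eq12 mod12 le_k k12 Ak.
have le := introT andP (conj (ltnW lt12) le2); have sz := size_cut le.
have [Gw' rem_w'] := cut_walk Gw le eq12.
exists (cut t1 t2 w); split=> //; last lia.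
  by apply/hasP; exists (nth x (x :: w) k); rewrite ?mem_cut.
apply/esym/eqP; rewrite eqn_mod_dvd; last lia.
rewrite -sz addKn -eqn_mod_dvd; last lia.
by rewrite mod12.
Qed.

(* If [v] lies outside [A], a visit [k] of [A] has to survive the shortening.
   Then the closed walks at [v] to be removed may be taken on both sides of
   [k], but the closed walk from the last visit [b] of [v] before [k] to the
   first visit [c] after [k] is kept: shifting the visits before [k] by
   [c - b] makes it invisible to the pigeonhole. *)
Lemma shorten_walk (A : {pred T}) n x y w v :
  0 < n -> walk G x y w -> has (mem A) (x :: w) ->
  n + (v \notin A) < count_mem v (x :: w) ->
  exists w', [/\ walk G x y w', has (mem A) (x :: w'), remove_cycles G x w w',
    size w' = size w %[mod n * cyclicity G] & size w' < size w].
Proof.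
move=> n_gt0 Gw /(has_nthP x)[k le_k Ak]; rewrite /= ltnS in le_k.
pose S := [seq t <- iota 0 (size w).+1 | nth x (x :: w) t == v].
have memS t : t \in S = (nth x (x :: w) t == v) && (t <= size w).
  by rewrite mem_filter mem_iota add0n.
have <- : size S = count_mem v (x :: w).
  by rewrite size_filter -[in RHS](mkseq_nth x (x :: w)) count_map.
have US : uniq S by rewrite filter_uniq ?iota_uniq.
have [a Sa] : exists a, {in S, forall t, t = a %[mod cyclicity G]}.
  case: (S) (memS) => [|a S'] memS'; first by exists 0.
  have := memS' a; rewrite mem_head => /esym/andP[/eqP va le_a].
  exists a => t; rewrite memS' => /andP[/eqP vt le_t].
  by apply: (visits_modn Gw); rewrite ?vt.
have pigeon : n < size S -> exists p1 p2 : nat, [/\ p1 \in S, p2 \in S, p1 < p2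
    & p1 = p2 %[mod n * cyclicity G]].
  by apply: pigeonhole_modn Sa.
have finish (p1 p2 k' : nat) : p1 \in S -> p2 \in S -> p1 < p2 ->
    p1 = p2 %[mod n * cyclicity G] -> k' <= size w ->
    nth x (x :: w) k' \in A -> (k' <= p1) || (p2 <= k') ->
  exists w', [/\ walk G x y w', has (mem A) (x :: w'), remove_cycles G x w w',
    size w' = size w %[mod n * cyclicity G] & size w' < size w].
  rewrite !memS => /andP[/eqP v1 le1] /andP[/eqP v2 le2] lt12 eq12 *.
  by apply: (@cut_shorten _ _ _ _ _ p1 p2 k'); rewrite ?lt12 ?v1.
have [Av | nAv] := boolP (v \in A).
  rewrite addn0 => /pigeon[p1 [p2 [S1 S2 lt12 eq12]]].
  apply: (finish p1 p2 p1); rewrite ?leqnn //; move: S1; rewrite memS.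
    by case/andP.
  by case/andP=> /eqP->.
rewrite addn1 => ltS.
have [|/hasPn Sge] := boolP (has (fun t => t < k) S); last first.
  have [p1 [p2 [S1 S2 lt12 eq12]]] := pigeon (ltnW ltS).
  by apply: (finish p1 p2 k) => //; rewrite leqNgt Sge.
have [|/hasPn Sle _] := boolP (has (fun t => k < t) S); last first.
  have [p1 [p2 [S1 S2 lt12 eq12]]] := pigeon (ltnW ltS).
  by apply: (finish p1 p2 k) => //; rewrite [p2 <= k]leqNgt Sle ?orbT.
move=> /hasP[c0 Sc0 lt_c0] /hasP[b0 Sb0 lt_b0].
have : exists c : nat, (c \in S) && (k < c) by exists c0; rewrite Sc0.
case/ex_minnP=> c /andP[Sc lt_kc] minc.
have : exists b : nat, (b \in S) && (b < k) by exists b0; rewrite Sb0.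
case/(@ex_maxnP _ k) => [b /andP[_ /ltnW] //|b /andP[Sb lt_bk] maxb].
have neq_k t : t \in S -> t != k.
  by rewrite memS => /andP[/eqP vt _]; apply: contraNneq nAv => tk; rewrite -vt tk.
pose f t := if t < k then t + (c - b) else t.
(* The shift gives [f b = c = f c]; one of these two visits is discarded to exclude this trivial
   collision. At least [n + 1] visits remain. *)
have : exists p1 p2 : nat, [/\ p1 \in rem c S, p2 \in rem c S, p1 < p2
    & f p1 = f p2 %[mod n * cyclicity G]].
  apply: (@pigeonhole_modn _ _ _ a); rewrite ?rem_uniq //; last first.
    by rewrite size_rem // -ltnS (ltn_predK ltS).
  move=> t /mem_rem St; rewrite /f; case: ifP => _; last exact: Sa.
  rewrite -modnDmr.
  have /eqP-> : (c - b) %% cyclicity G == 0.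
    by rewrite -/(_ %| _) -eqn_mod_dvd ?(Sa c) ?(Sa b) // ltnW // (ltn_trans lt_bk).
  by rewrite addn0 Sa.
move=> [p1 [p2 []]]; rewrite !(mem_rem_uniq c US) !inE.
move=> /andP[neq1 S1] /andP[neq2 S2] lt12; rewrite /f.
case: ltnP => lt1; case: ltnP => lt2.
- by move/eqP; rewrite eqn_modDr => /eqP eq12; apply: (finish p1 p2 k);
    rewrite // (ltnW lt2) orbT.
(* Here [p1 <= b < k < c < p2]. The later piece, from [c] to [p2], is cut first so that earlier
   positions do not move; then the piece from [p1] to [b] is cut. Together they have length
   [f p2 - f p1], which is positive even if [p1 = b]. *)
- have lt_c2 : c < p2.
    rewrite ltn_neqAle eq_sym neq2 minc // S2 ltn_neqAle lt2.
    by rewrite eq_sym neq_k.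
  have le_1b : p1 <= b by rewrite maxb // S1.
  move=> eq12; move: Sc Sb S1 S2; rewrite !memS.
  move=> /andP[/eqP vc lec] /andP[/eqP vb leb].
  move=> /andP[/eqP v1 le1] /andP[/eqP v2 le2].
  have le_c2 : c <= p2 <= size w by rewrite (ltnW lt_c2).
  have [Gw1 rem1] := cut_walk Gw le_c2 (etrans vc (esym v2)).
  have sz1 := size_cut le_c2; set w1 := cut c p2 w in Gw1 rem1 sz1.
  have nth1 t : t <= c -> nth x (x :: w1) t = nth x (x :: w) t.
    by move=> le_t; apply: nth_cut_before.
  have [le_b1 le_k1] : b <= size w1 /\ k <= size w1.
    by move: sz1 le_c2 lt_bk lt_kc; clear; lia.
  have le_1b1 : p1 <= b <= size w1 by rewrite le_1b.
  have lt_bc := ltn_trans lt_bk lt_kc.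
  have eq1b : nth x (x :: w1) p1 = nth x (x :: w1) b.
    by rewrite !nth1 ?v1 ?vb // ltnW // (leq_ltn_trans le_1b).
  have [Gw2 rem2] := cut_walk Gw1 le_1b1 eq1b.
  have sz2 := size_cut le_1b1; set w2 := cut p1 b w1 in Gw2 rem2 sz2.
  have [lt_w2 def_w2] : size w2 < size w /\ size w - size w2 = p2 - (p1 + (c - b)).
    by move: sz1 sz2 lt_c2 le_c2 le_1b lt_bc; clear; lia.
  exists w2; split=> //.
  + apply/hasP; exists (nth x (x :: w) k) => //.
    by rewrite -(nth1 k (ltnW lt_kc)) mem_cut ?(ltnW lt_bk) ?orbT.
  + exact: remove_cycles_trans rem1 rem2.
  apply/esym/eqP; rewrite eqn_mod_dvd ?(ltnW lt_w2) // def_w2.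
  rewrite -eqn_mod_dvd ?eq12 //.
  by move: lt_c2 le_1b lt_bc; clear; lia.
- by have := ltn_trans (leq_ltn_trans lt1 lt12) lt2; rewrite ltnn.
by move=> eq12; apply: (finish p1 p2 k); rewrite ?lt1.
Qed.

End Removal.

(** * Cyclic classes and the counting of visits *)

Section Classes.
Variables (T : finType) (G : digraph T).
Hypothesis G_conn : strongly_connected G.
Implicit Types (x y : T) (p w Z : seq T).

Let g := cyclicity G.

Lemma is_cycle_cyclicity_gt0 Z : is_cycle G Z -> 0 < g.
Proof.
move=> GZ; have dvdZ := (dvdn_cyclicity G g).1 (dvdnn _) Z GZ.
by apply: dvdn_gt0 dvdZ; case/and3P: GZ => + _ _; rewrite -size_eq0 lt0n.
Qed.

Lemma path_nodes x p :
  x \in nodes G -> path (arcs G) x p -> last x p \in nodes G.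
Proof.
by elim: p x => //= y p IH x _ /andP[/arcs_nodes/andP[_ Gy] /(IH y Gy)].
Qed.

(** The class of a node is the length modulo [g] of any path from [x] to it. Two such paths agree
    because one common return path closes both, and closed walks have length divisible by [g]. *)
Lemma cyclic_classes x : x \in nodes G -> 0 < g ->
  exists cls : T -> nat, (forall y, cls y < g) /\
    forall p, path (arcs G) x p -> cls (last x p) = size p %% g.
Proof.
move=> Gx g_gt0.
have /choice[cls clsP] : forall y, exists n : nat, n < g /\
    forall p, path (arcs G) x p -> last x p = y -> n = size p %% g.
  move=> y; have [/connectP[p Gp ->] | no_path] := boolP (connect (arcs G) x y).
    exists (size p %% g); split=> [|q Gq eq_pq]; first by rewrite ltn_mod.
    have /connectP[r Gr last_r] := G_conn (path_nodes Gx Gp) Gx.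
    have /eqP p0 : g %| size (p ++ r).
      by apply: (@closed_walk_dvd _ _ x); rewrite ?cat_path ?last_cat ?Gp.
    have /eqP q0 : g %| size (q ++ r).
      by apply: (@closed_walk_dvd _ _ x); rewrite ?cat_path ?last_cat ?Gq eq_pq.
    by apply/eqP; rewrite -(eqn_modDr (size r)) -!size_cat p0 q0.
  (* Elements that [x] does not reach get class 0, so that the classes partition all of [T]. *)
  exists 0; split=> // p Gp last_p; case/negP: no_path.
  by apply/connectP; exists p.
exists cls; split=> [y|p Gp]; first by case: (clsP y).
by have [_] := clsP (last x p); apply.
Qed.

(** Along [p'] the class grows by one modulo [g] at each arc, so visits to a class are positions in
    one residue class. The prefix [p] allows counting to start away from [x], for instance on
    [Z]. *)
Lemma leq_count_class (cls : T -> nat) x p p' N r b :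
  (forall q, path (arcs G) x q -> cls (last x q) = size q %% g) ->
  path (arcs G) x (p ++ p') -> N * g + r <= (size p').+1 -> b < g ->
  N + (b < r) <=
    count (fun y => cls y == (size p + b) %% g) (last x p :: p').
Proof.
move=> clsP Gp le_size lt_b; set z := last x p.
apply: leq_trans (leq_count_modn lt_b le_size) _.
rewrite -(mkseq_nth z (z :: p')) count_map leq_eqVlt.
apply/orP; left; apply/eqP/eq_in_count => t; rewrite mem_iota /= ltnS => le_t.
rewrite -last_take // -last_cat clsP; last first.
  by move: Gp; rewrite -{1}(cat_take_drop t p') catA cat_path => /andP[].
by rewrite size_cat size_takel // eqn_modDl (modn_small lt_b).
Qed.

Lemma sum_count_mem (P : pred T) w :
  \sum_(y | P y) count_mem y w = count P w.
Proof.
elim: w => [|z w IH] /=; first by rewrite big1.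
rewrite big_split /= IH; congr (_ + _).
case: (boolP (P z)) => [Pz | nPz].
  by rewrite (bigD1 z) //= eqxx big1 // => y /andP[_ /negPf]; rewrite eq_sym => ->.
by rewrite big1 // => y Py; case: eqP nPz => // ->; rewrite Py.
Qed.

Lemma frequent_node Z x y w : is_cycle G Z -> walk G x y w ->
  size Z * (#|T| %/ g) + #|T| - size Z <= size w ->
  exists v, size Z %/ g + (v \notin Z) < count_mem v (x :: w).
Proof.
move=> GZ /and3P[Gx Gw _] le_w.
have g_gt0 := is_cycle_cyclicity_gt0 GZ.
have dvdZ := (dvdn_cyclicity G g).1 (dvdnn _) Z GZ.
have [cls [lt_cls clsP]] := cyclic_classes Gx g_gt0.
set s := size Z %/ g; set q := #|T| %/ g in le_w; set r := #|T| %% g.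
have def_Z : size Z = s * g by rewrite divnK.
clearbody s.
have def_T : #|T| = q * g + r := divn_eq _ _.
have UZ : uniq Z by case/and3P: GZ.
have Z_gt0 : 0 < size Z.
  by rewrite lt0n size_eq0; case/and3P: GZ.
have le_ZT : size Z <= #|T| by rewrite -(card_uniqP UZ) max_card.
have q_gt0 : 0 < q.
  by rewrite divn_gt0 // (leq_trans (dvdn_leq Z_gt0 dvdZ)).
apply: contrapT => /forallNP visits.
have {}visits v : count_mem v (x :: w) <= s + (v \notin Z).
  by rewrite leqNgt; apply/negP/visits.
pose C b := [pred v | cls v == b].
have count_Z b : b < g -> s <= count (C b) Z.
  move=> lt_b; case: Z GZ def_Z {le_w dvdZ UZ Z_gt0 le_ZT visits}.
    by case/and3P.
  move=> z Z' GZ def_Z; have /and3P[_ cycZ _] := GZ.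
  have Gz : z \in nodes G.
    by have [/subsetP sub _] := cycle_graph_sub GZ; rewrite sub // inE mem_head.
  have /connectP[p Gp def_z] := G_conn Gx Gz.
  (* The offset from [z], of class [size p %% g], to class [b]. Going round [Z] from [z] meets
     [s * g] nodes, that is [s] full periods. *)
  pose b' := (b + (g - size p %% g)) %% g.
  have lt_b' : b' < g by rewrite ltn_mod.
  have eq_b : (size p + b') %% g = b.
    have p0 : (size p + (g - size p %% g)) %% g = 0.
      by rewrite -modnDml subnKC ?modnn // ltnW // ltn_mod.
    by rewrite modnDmr addnCA -modnDmr p0 addn0 modn_small.
  have := @leq_count_class cls x p Z' s 0 b' clsP.
  rewrite eq_b -def_z addn0 ltn0 addn0; apply=> //; last by rewrite -def_Z.
  rewrite cat_path Gp -def_z; move: cycZ; rewrite /= rcons_path.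
  by case/andP.
(* The walk has at least [(q * s.+1 - s) * g + r.+1] nodes, counting its start: this is the assumed
   length bound rewritten with [size Z = s * g] and [#|T| = q * g + r]. *)
have count_w b : b < g -> q * s.+1 - s + (b < r.+1) <= count (C b) (x :: w).
  move=> lt_b.
  have := @leq_count_class cls x [::] w (q * s.+1 - s) r.+1 b clsP Gw.
  rewrite add0n (modn_small lt_b); apply=> //.
  rewrite addnS ltnS (leq_trans _ le_w) // mulnBl -def_Z.
  have -> : q * s.+1 * g = size Z * q + q * g by rewrite def_Z mulnS; lia.
  by rewrite def_T addnA addnBAC // (leq_trans (leq_pmulr _ q_gt0)) ?leq_addr.
have le_C b : b < g -> q + (b <= r) <= #|C b|.
  move=> lt_b; have : count (C b) (x :: w) + s <= #|C b| * s.+1.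
    (* Adding the occurrences in [Z] makes the bound on visits uniform: every node of the class now
       contributes at most [s.+1]. *)
    apply: (@leq_trans (count (C b) (x :: w) + count (C b) Z)).
      by rewrite leq_add2l count_Z.
    rewrite -!sum_count_mem -big_split /= -sum_nat_const.
    apply: leq_sum => v _; rewrite (count_uniq_mem v UZ).
    apply: leq_trans (leq_add (visits v) (leqnn _)) _.
    by rewrite -addnA; case: (v \in Z); rewrite addn1.
  have := count_w b lt_b; rewrite ltnS => le1 le2.
  rewrite leqNgt; apply/negP => lt_card.
  have := leq_trans (leq_add le1 (leqnn s)) le2.
  by case: (b <= r) lt_card => /=; nia.
have := ltn_mod #|T| g; rewrite g_gt0 -/r => lt_r.
have : \sum_(b < g) (q + (b <= r)) <= \sum_(b < g) #|C b|.
  by apply: leq_sum => b _; apply: le_C.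
have -> : \sum_(b < g) #|C b| = #|T|.
  rewrite -[RHS]sum1_card (partition_big (fun v => Ordinal (lt_cls v)) predT) //=.
  by apply: eq_bigr => b _; rewrite -sum1_card.
rewrite big_split /= sum_nat_const card_ord.
have -> : \sum_(b < g) (b <= r) = r.+1.
  rewrite -(big_mkord predT (fun b => (b <= r) : nat)).
  rewrite (@big_cat_nat _ _ _ r.+1) //= [X in _ + X]big_nat [X in _ + X]big1 ?addn0.
    rewrite (@eq_big_nat _ _ _ _ _ _ (fun=> 1)) => [|b].
      by rewrite sum_nat_const_nat subn0 muln1.
    by rewrite ltnS => /andP[_ ->].
  by move=> b /andP[lt_rb _]; rewrite leqNgt lt_rb.
by rewrite def_T mulnC; lia.
Qed.

End Classes.

(** * The bound on the threshold *)

Section Threshold.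
Variables (R : realType) (d : nat).
Implicit Types (A : 'M[Rmax R]_d) (G : digraph 'I_d).

(** A walk above the bound has a node visited too often, hence can be shortened; this is iterated
    until the bound is met. Only removals occur, so nothing is inserted from [Z]. *)
Lemma cycle_removal_cycle A (Z : seq 'I_d) :
  irreducible A -> is_cycle (digraph_of A) Z ->
  cycle_removal A (cycle_graph Z) (size Z)
    (size Z * (d %/ cyclicity (digraph_of A)) + d - size Z - 1).
Proof.
set H := digraph_of A => A_irr HZ i j w Hw Zw _.
have dvdZ := (dvdn_cyclicity H _).1 (dvdnn _) Z HZ.
have Z_gt0 : 0 < size Z by rewrite lt0n size_eq0; case/and3P: HZ.
have s_gt0 : 0 < size Z %/ cyclicity H.
  by rewrite divn_gt0 ?(dvdn_leq Z_gt0) // (is_cycle_cyclicity_gt0 HZ).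
suff [v [Hv Zv rem_v eq_v le_v]] : exists v, [/\ walk H i j v,
    goes_through (cycle_graph Z) i v, remove_cycles H i w v,
    size v = size w %[mod size Z]
  & size v <= size Z * (d %/ cyclicity H) + d - size Z - 1].
  exists v; split=> //; exists v => //; exact: remove_none.
have [n] := ubnP (size w); elim: n => // n IH in w Hw Zw * => lt_w.
case: (leqP (size w) (size Z * (d %/ cyclicity H) + d - size Z - 1)) => [le_w|].
  by exists w; split=> //; apply: remove_none.
move=> lt_Tw.
have [|v many_v] := frequent_node A_irr HZ Hw.
  by rewrite card_ord (leq_trans (leqSpred _)) // -subn1.
have := @shorten_walk _ H (mem (nodes (cycle_graph Z))) _ i j w v s_gt0 Hw Zw.
rewrite inE divnK // => /(_ many_v)[w' [Hw' Zw' rem_w' eq_w' lt_w']].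
have [|u [Hu Zu rem_u eq_u le_u]] := IH w' Hw' Zw'.
  exact: leq_trans lt_w' _.
exists u; split=> //; first exact: remove_cycles_trans rem_w' rem_u.
exact: etrans eq_u eq_w'.
Qed.

Lemma is_Tcr_exists A G m T0 : cycle_removal A G m T0 ->
  exists2 T, is_Tcr A G m T & T <= T0.
Proof.
move=> T0P; have : exists n, `[< cycle_removal A G m n >].
  by exists T0; apply/asboolP.
case/ex_minnP=> T /asboolP TP minT; exists T; last exact/minT/asboolP.
by split=> // T' T'P; apply/minT/asboolP.
Qed.

End Threshold.

Theorem corollary4p6 (R : realType) (d : nat) (A : 'M[Rmax R]_d)
    (Z : seq 'I_d) (A_irr : irreducible A) (Z_cyc : is_cycle (digraph_of A) Z) :
  exists T : nat,
    is_Tcr A (cycle_graph Z) (size Z) T /\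
    (T%:Z <= (size Z)%:Z * (d %/ cyclicity (digraph_of A))%N%:Z
             + d%:Z - (size Z)%:Z - 1)%R.
Proof.
have [T TP le_T] := is_Tcr_exists (cycle_removal_cycle A_irr Z_cyc).
(* It remains to see that the subtractions in [nat] do not truncate: [size Z <= size Z * q], where
   [q > 0] is the quotient of [d] by the cyclicity, and [d >= size Z > 0]. *)
exists T; split=> //.
have UZ : uniq Z by case/and3P: Z_cyc.
have le_Zd : size Z <= d by rewrite -(card_uniqP UZ) -[d in _ <= d]card_ord max_card.
have Z_gt0 : 0 < size Z by rewrite lt0n size_eq0; case/and3P: Z_cyc.
have dvdZ := (dvdn_cyclicity _ _).1 (dvdnn _) Z Z_cyc.
have : 0 < d %/ cyclicity (digraph_of A).
  rewrite divn_gt0 ?(leq_trans (dvdn_leq Z_gt0 dvdZ)) //.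
  exact: is_cycle_cyclicity_gt0 Z_cyc.
move: le_T; move: (d %/ _) => q le_T q_gt0.
have : size Z <= size Z * q by rewrite leq_pmulr.
rewrite -PoszM; move: (size Z * q) le_T => m le_T le_m.
by lia.
Qed.
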